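(* Let $T$ be a tree on $n\geq 4$ vertices which is not a star, and let $T^c$ be its complement. Then $tr(T^c)=6$ if $T$ is a bistar, and $tr(T^c)=5$ if $T$ is not a bistar.
   Context: All graphs are finite, simple and undirected. $d(u,v)$ denotes the usual shortest-path distance. The triameter of a connected graph $G=(V,E)$ on at least $3$ vertices is $tr(G)=\max\{d(u,v)+d(v,w)+d(u,w): u,v,w\in V\}$. A star is a graph $K_{1,m}$. A bistar is a graph obtained by joining by an edge the root (central) vertices of two stars $K_{1,n_1}$ and $K_{1,n_2}$, with $n_1,n_2\geq 1$; it has $n_1+n_2+2$ vertices. (The complement of a tree that is not a star is connected.) *)

(* Defs.v *)
From mathcomp Require Import all_boot.

Set Implicit Arguments.
Unset Strict Implicit.
Unset Printing Implicit Defensive.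

Record sgraph := SGraph {
  vertex :> finType;
  edge : rel vertex;
  edge_sym : symmetric edge;
  edge_irrefl : irreflexive edge }.

Definition graph_iso (G H : sgraph) : Prop :=
  exists f : G -> H, bijective f /\ forall x y, edge (f x) (f y) = edge x y.

Section Complement.
Variable G : sgraph.

Definition compl_edge : rel G := fun x y => (x != y) && ~~ edge x y.

Lemma compl_edge_sym : symmetric compl_edge.
Proof. by move=> x y; rewrite /compl_edge eq_sym edge_sym. Qed.

Lemma compl_edge_irrefl : irreflexive compl_edge.
Proof. by move=> x; rewrite /compl_edge eqxx. Qed.

Definition compl : sgraph := SGraph compl_edge_sym compl_edge_irrefl.

End Complement.

Definition connected (G : sgraph) : Prop := forall x y : G, connect (@edge G) x y.

Definition acyclic (G : sgraph) : Prop :=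
  forall p : seq G, 2 < size p -> ~ ucycle (@edge G) p.

(* The empty graph is not a tree. *)
Definition is_tree (G : sgraph) : Prop :=
  [/\ 0 < #|G|, connected G & acyclic G].

(* K_{1,m}: the root is [None], the leaves are the [Some i]. *)
Definition star_edge (m : nat) : rel (option 'I_m) :=
  fun x y => (x == None) (+) (y == None).

Lemma star_edge_sym m : symmetric (@star_edge m).
Proof. by move=> x y; rewrite /star_edge addbC. Qed.

Lemma star_edge_irrefl m : irreflexive (@star_edge m).
Proof. by move=> x; rewrite /star_edge addbb. Qed.

Definition star (m : nat) : sgraph :=
  SGraph (@star_edge_sym m) (@star_edge_irrefl m).

Definition is_star (G : sgraph) : Prop := exists m, graph_iso G (star m).

Definition bistar_edge (n1 n2 : nat) : rel (star n1 + star n2)%type :=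
  fun x y => match x, y with
  | inl a, inl b => edge a b
  | inr a, inr b => edge a b
  | inl a, inr b => (a == None) && (b == None)
  | inr a, inl b => (a == None) && (b == None)
  end.

Lemma bistar_edge_sym n1 n2 : symmetric (@bistar_edge n1 n2).
Proof. by move=> [x|x] [y|y] /=; rewrite 1?andbC 1?star_edge_sym. Qed.

Lemma bistar_edge_irrefl n1 n2 : irreflexive (@bistar_edge n1 n2).
Proof. by move=> [x|x]; apply: star_edge_irrefl. Qed.

Definition bistar (n1 n2 : nat) : sgraph :=
  SGraph (@bistar_edge_sym n1 n2) (@bistar_edge_irrefl n1 n2).

Definition is_bistar (G : sgraph) : Prop :=
  exists n1 n2, [/\ 0 < n1, 0 < n2 & graph_iso G (bistar n1 n2)].

(* [p] lists the vertices of the path after [u], so its size is the number of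
   edges. *)
Definition is_path (G : sgraph) (u v : G) (p : seq G) : bool :=
  [&& path (@edge G) u p, uniq (u :: p) & last u p == v].

(* The least length of a path from [u] to [v].  Paths have length less than
   #|G|; when there is none, [find] returns #|G|. *)
Definition dist (G : sgraph) (u v : G) : nat :=
  find (fun k => [exists p : k.-tuple G, is_path u v p]) (iota 0 #|G|).

(* Only meaningful for connected [G].  If [G] is disconnected the value is at
   least 2 * #|G|, because of the default of [dist] (take w = u with u and v in
   different components). *)
Definition triameter (G : sgraph) : nat :=
  \max_(u : G) \max_(v : G) \max_(w : G) (dist u v + dist v w + dist u w).

(* Main.v *)
Require Import Defs.
From mathcomp Require Import all_boot.

(** Write Tc for the complement of the tree T.  Two distinct vertices are at
    distance 1 in Tc exactly when they are not adjacent in T.  The ends of an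
    edge u v of T are at distance 2 when some vertex is adjacent in T to
    neither of them.  Otherwise u v is a dominating edge, and the distance is
    3: as T is not a star, there are a vertex a adjacent to u and not to v and
    a vertex b adjacent to v and not to u; as T has no 4-cycle, u, b, a, v is a
    path of Tc ([dist_compl]).  Moreover a tree that is not a star has a
    dominating edge if and only if it is a bistar, and then the roots of the
    two stars are the ends of such an edge ([bistar_dominating],
    [dominating_bistar]).

    Let three distinct vertices be given.  As T has no triangle, two of them
    are at distance 1 in Tc; and at most one of the three pairs is a dominating
    edge, because distinct dominating edges never share a vertex
    ([dominating_inj]).  So their distances add up to at most 1 + 2 + 2, or
    1 + 2 + 3 if T has a dominating edge.  When two of the three vertices
    coincide, the sum is twice a distance: at most 4, or 6 if T has a
    dominating edge ([dist_compl_sum]).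

    The bound 6 is attained by (u, v, v) with u v a dominating edge, and the
    bound 5 by a path u, x, y of T. *)

Set Implicit Arguments.
Unset Strict Implicit.
Unset Printing Implicit Defensive.

(** * Distances and the triameter *)

Lemma find_iota_min (P : pred nat) (n k : nat) :
  k < n -> P k -> (forall j, P j -> k <= j) -> find P (iota 0 n) = k.
Proof.
move=> ltkn Pk mink.
have hasP : has P (iota 0 n) by apply/hasP; exists k; rewrite ?mem_iota.
apply/eqP; rewrite eqn_leq; apply/andP; split.
  rewrite leqNgt; apply/negP => /(before_find 0).
  by rewrite nth_iota // add0n Pk.
have := nth_find 0 hasP.
by rewrite nth_iota ?add0n; [apply: mink | rewrite -[n in _ < n](size_iota 0) -has_find].
Qed.

Lemma dist_shortest (G : sgraph) (u v : G) (p : seq G) :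
  is_path u v p -> (forall q, is_path u v q -> size p <= size q) ->
  dist u v = size p.
Proof.
move=> uvp minp; apply: find_iota_min.
- have /and3P[_ uniq_up _] := uvp.
  by have := max_card (mem (u :: p)); rewrite (card_uniqP uniq_up).
- by apply/existsP; exists (in_tuple p).
- by move=> j /existsP[q /minp]; rewrite size_tuple.
Qed.

Lemma triameter_max (G : sgraph) (k : nat) (a b c : G) :
  (forall u v w : G, dist u v + dist v w + dist u w <= k) ->
  dist a b + dist b c + dist a c = k -> triameter G = k.
Proof.
move=> lek eqk; apply/eqP; rewrite eqn_leq; apply/andP; split.
  by apply/bigmax_leqP => u _; apply/bigmax_leqP => v _; apply/bigmax_leqP.
rewrite -eqk; apply: leq_trans (leq_bigmax a).
by apply: leq_trans (leq_bigmax b); apply: leq_trans (leq_bigmax c).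
Qed.

(** * Recognizing stars and bistars *)

(** Isomorphisms onto stars and bistars are easier to build from the concrete
    graph, where a vertex is given by its position, as [enum_val] numbers the
    neighbours of a root. *)
Lemma graph_iso_inv (G H : sgraph) (g : H -> G) :
  injective g -> (forall x, x \in codom g) ->
  (forall x y, edge (g x) (g y) = edge x y) -> graph_iso G H.
Proof.
move=> g_inj g_surj g_edge.
have [f gK fK] : bijective g.
  apply: inj_card_bij => //; rewrite -(card_codom g_inj).
  by apply/subset_leq_card/subsetP.
by exists f; split=> [|x y]; [exists g | rewrite -g_edge !fK].
Qed.

Section AcyclicGraph.
Variables (T : sgraph) (acyclT : acyclic T).
Implicit Types u v w x : T.

Lemma edge_neq u v : edge u v -> u != v.
Proof. by apply: contraTneq => ->; rewrite edge_irrefl. Qed.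

Lemma no_triangle u v w : edge u v -> edge v w -> edge u w = false.
Proof.
move=> uv vw; apply/negP => uw; apply: (@acyclT [:: u; v; w]) => //.
rewrite /ucycle /= uv vw edge_sym uw !inE /=.
by rewrite negb_or !edge_neq.
Qed.

Lemma no_square u v w x :
  u != w -> v != x -> edge u v -> edge v w -> edge w x -> edge u x = false.
Proof.
move=> nuw nvx uv vw wx; apply/negP => ux.
apply: (@acyclT [:: u; v; w; x]) => //.
rewrite /ucycle /= uv vw wx edge_sym ux !inE /=.
by rewrite !negb_or nuw nvx !edge_neq.
Qed.

Lemma universal_star u : (forall x, x != u -> edge u x) -> is_star T.
Proof.
move=> univ; pose A := [pred x | edge u x]; exists #|A|.
have uA i : edge u (@enum_val _ A i) by apply: enum_valP.
pose g (x : star #|A|) : T := if x is Some i then enum_val i else u.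
apply: (@graph_iso_inv _ _ g).
- move=> [i|] [j|] //=; first by move/enum_val_inj->.
    by move=> eu; have := uA i; rewrite eu edge_irrefl.
  by move=> eu; have := uA j; rewrite -eu edge_irrefl.
- move=> x; case: (eqVneq x u) => [->|/univ ux].
    by apply/codomP; exists None.
  by apply/codomP; exists (Some (enum_rank_in ux x)); rewrite /= enum_rankK_in.
- move=> [i|] [j|] /=; rewrite /star_edge /= ?edge_irrefl ?uA //.
    by apply: (@no_triangle _ u); rewrite ?uA // edge_sym uA.
  by rewrite edge_sym uA.
Qed.

Hypothesis not_star : ~ is_star T.

Lemma nonadjacent_vertex u : exists2 x, x != u & ~~ edge u x.
Proof.
case: (boolP [exists x, (x != u) && ~~ edge u x]) => [/existsP[x /andP[]]|].
  by exists x.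
rewrite negb_exists => /forallP univ; case: not_star.
apply: (@universal_star u) => x nxu.
by have := univ x; rewrite nxu negbK.
Qed.

(** * Dominating edges *)

Definition dominating u v := edge u v && [forall x, edge u x || edge v x].

Lemma dominating_sym u v : dominating u v = dominating v u.
Proof.
rewrite /dominating edge_sym; congr (_ && _).
by apply: eq_forallb => x; rewrite orbC.
Qed.

Lemma dominatingP u v :
  dominating u v -> edge u v /\ forall x, ~~ edge u x -> edge v x.
Proof.
case/andP=> uv /forallP dom; split=> // x /negPf nux.
by have := dom x; rewrite nux.
Qed.

(** If u v and v w were distinct dominating edges, a vertex not adjacent to v
    would be adjacent to both u and w and close a 4-cycle, so that T would be
    a star rooted at v. *)
Lemma dominating_inj u v w : dominating u v -> dominating v w -> u = w.
Proof.
rewrite dominating_sym.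
move=> /dominatingP[vu dom_u] /dominatingP[vw dom_w]; apply/eqP.
have [x nxv nvx] := nonadjacent_vertex v.
apply: contraT => nuw.
have := @no_square u v w x nuw; rewrite eq_sym nxv edge_sym vu vw dom_w //.
by rewrite dom_u // => /(_ isT isT isT isT).
Qed.

(** Take for b a vertex not adjacent to u, hence adjacent to v, and for a a
    vertex not adjacent to v, hence adjacent to u: were a and b adjacent, they
    would form a 4-cycle with u and v. *)
Lemma dominating_path u v : dominating u v ->
  exists a b, [/\ compl_edge u b, compl_edge b a & compl_edge a v].
Proof.
move=> uv_dom.
have [uv dom_v] := dominatingP uv_dom.
have [_ dom_u] := dominatingP (etrans (dominating_sym v u) uv_dom).
have [b nbu nub] := nonadjacent_vertex u.
have [a nav nva] := nonadjacent_vertex v.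
have ua := dom_u _ nva; have vb := dom_v _ nub.
exists a, b; rewrite /compl_edge eq_sym nbu nub nav (edge_sym a) nva; split=> //.
rewrite edge_sym (@no_square a u v b) // ?andbT; last by rewrite edge_sym.
  by apply: contraNneq nub => ->.
by rewrite eq_sym.
Qed.

(** The neighbours of u other than v and those of v other than u are the leaves
    of the two stars: a further edge would close a triangle or a 4-cycle.
    Both stars have leaves because neither u nor v is adjacent to every other
    vertex. *)
Lemma dominating_bistar u v : dominating u v -> is_bistar T.
Proof.
move=> uv_dom.
have [uv dom_v] := dominatingP uv_dom.
have [_ dom_u] := dominatingP (etrans (dominating_sym v u) uv_dom).
pose A := [pred x | edge u x && (x != v)].
pose B := [pred x | edge v x && (x != u)].
have [b nbu nub] := nonadjacent_vertex u.
have [a nav nva] := nonadjacent_vertex v.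
have Aa : a \in A by rewrite inE dom_u.
have Bb : b \in B by rewrite inE dom_v.
exists #|A|, #|B|; split; [by apply/card_gt0P; exists a | by apply/card_gt0P; exists b |].
have uA i : edge u (@enum_val _ A i) by have /andP[] := enum_valP i.
have vB i : edge v (@enum_val _ B i) by have /andP[] := enum_valP i.
have Av i : @enum_val _ A i != v by have /andP[] := enum_valP i.
have Bu i : @enum_val _ B i != u by have /andP[] := enum_valP i.
have vA i : edge v (@enum_val _ A i) = false.
  by apply: (@no_triangle v u); rewrite // edge_sym.
have uB i : edge u (@enum_val _ B i) = false by apply: (@no_triangle u v).
have AA i j : edge (@enum_val _ A i) (@enum_val _ A j) = false.
  by apply: (@no_triangle _ u); rewrite // edge_sym.
have BB i j : edge (@enum_val _ B i) (@enum_val _ B j) = false.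
  by apply: (@no_triangle _ v); rewrite // edge_sym.
have AB i j : edge (@enum_val _ A i) (@enum_val _ B j) = false.
  by apply: (@no_square _ u v); rewrite // 1?edge_sym // eq_sym.
have nuv := edge_neq uv.
pose g (x : bistar #|A| #|B|) : T := match x with
  | inl (Some i) => enum_val i
  | inl None => u
  | inr (Some i) => enum_val i
  | inr None => v
  end.
have g_inj : injective g.
{ have nuA i : u != @enum_val _ A i by apply: edge_neq.
  have nvB i : v != @enum_val _ B i by apply: edge_neq.
  have nAB i j : @enum_val _ A i != @enum_val _ B j.
    by apply: contraTneq (uA i) => ->; rewrite uB.
  have diff := (negPf nuv, fun i => negPf (nuA i), fun i => negPf (nvB i),
    fun i j => negPf (nAB i j), fun i => negPf (Av i), fun i => negPf (Bu i)).
  move=> [[i|]|[i|]] [[j|]|[j|]] //= eqg.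
  all: try by rewrite (enum_val_inj eqg).
  all: by move/eqP: eqg; rewrite ?diff // eq_sym diff. }
apply: (@graph_iso_inv _ _ g) => //.
- move=> x; apply/codomP.
  case: (eqVneq x u) => [->|nxu]; first by exists (inl None).
  case: (eqVneq x v) => [->|nxv]; first by exists (inr None).
  case: (boolP (edge u x)) => [ux|/dom_v vx].
    have Ax : x \in A by rewrite inE ux.
    by exists (inl (Some (enum_rank_in Ax x))); rewrite /= enum_rankK_in.
  have Bx : x \in B by rewrite inE vx.
  by exists (inr (Some (enum_rank_in Bx x))); rewrite /= enum_rankK_in.
- have vu : edge v u by rewrite edge_sym.
  have Au i : edge (@enum_val _ A i) u by rewrite edge_sym.
  have Bv i : edge (@enum_val _ B i) v by rewrite edge_sym.
  have vA' i : edge (@enum_val _ A i) v = false by rewrite edge_sym.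
  have uB' i : edge (@enum_val _ B i) u = false by rewrite edge_sym.
  have BA i j : edge (@enum_val _ B i) (@enum_val _ A j) = false.
    by rewrite edge_sym.
  by move=> [[i|]|[i|]] [[j|]|[j|]] /=;
    rewrite /star_edge /= ?edge_irrefl ?uA ?Au ?vB ?Bv.
Qed.

(** * Distances in the complement *)

(** The three terms count the successive reasons for a shortest path of the
    complement to be longer: an edge of the tree cannot be used directly, and a
    dominating edge leaves no vertex to go through.  Written as a sum, the
    formula reduces the bounds on sums of distances to bounds on numbers of
    edges and of dominating edges. *)
Lemma dist_compl u v :
  @dist (compl T) u v = (u != v) + edge u v + dominating u v.
Proof.
have [<-|nuv] := eqVneq u v.
  rewrite /dominating edge_irrefl.
  by apply: (@dist_shortest (compl T) _ _ [::]); rewrite // /is_path /= eqxx.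
have [uv|nonuv] /= := boolP (edge u v); last first.
  rewrite /dominating (negPf nonuv).
  apply: (@dist_shortest (compl T) _ _ [:: v]).
    by rewrite /is_path /= /compl_edge nuv nonuv inE nuv eqxx.
  by case=> // /and3P[_ _]; rewrite /= (negPf nuv).
have long q : @is_path (compl T) u v q -> 1 < size q.
  case: q => [|x [|y q]] // /and3P[] /=; first by rewrite (negPf nuv).
  by rewrite andbT => /andP[_ nux] _ /eqP eqx; rewrite -eqx (negPf nux) in uv.
have [uv_dom|not_dom] := boolP (dominating u v).
  have [a [b [ub ba av]]] := dominating_path uv_dom.
  apply: (@dist_shortest (compl T) _ _ [:: b; a; v]).
    have [/andP[nub n_ub] /andP[nba _] /andP[nav n_av]] := And3 ub ba av.
    have nua : u != a by apply: contraNneq n_av => <-.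
    have nbv : b != v by apply: contraNneq n_ub => ->.
    by rewrite /is_path /= ub ba av !inE !negb_or nub nua nuv nba nbv nav eqxx.
  case=> [|x [|y [|z q]]] // uvq; try by have := long _ uvq.
  (* The middle vertex of a path u, x, v of the complement would be adjacent
     to neither u nor v. *)
  have /and3P[/= /and3P[/andP[_ nux] /andP[_ nxy] _] _ /eqP eqy] := uvq.
  have [_ /(_ _ nux)] := dominatingP uv_dom.
  by rewrite -eqy edge_sym (negPf nxy).
have [x] : exists x, ~~ (edge u x || edge v x).
  by apply/existsP; move: not_dom; rewrite /dominating uv negb_forall.
rewrite negb_or => /andP[nux nvx].
have nxu : u != x by apply: contraNneq nvx => <-; rewrite edge_sym.
have nxv : x != v by apply: contraNneq nux => ->.
apply: (@dist_shortest (compl T) _ _ [:: x; v]) => //.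
rewrite /is_path /= /compl_edge !inE !negb_or nxu nxv nuv nux eqxx.
by rewrite edge_sym nvx.
Qed.

(** The right-hand side is 6 or 5 according to whether there is a dominating
    edge, so that the two upper bounds have a common proof. *)
Lemma dist_compl_sum u v w :
  @dist (compl T) u v + @dist (compl T) v w + @dist (compl T) u w
    <= 5 + [exists x, exists y, dominating x y].
Proof.
set D := [exists x, _].
have leD x y : dominating x y <= D.
  case: (boolP (dominating x y)) => // xy; rewrite lt0b.
  by apply/existsP; exists x; apply/existsP; exists y.
have dist0 x : @dist (compl T) x x = 0.
  by rewrite dist_compl eqxx /dominating edge_irrefl.
have distC x y : @dist (compl T) x y = @dist (compl T) y x.
  by rewrite !dist_compl eq_sym edge_sym dominating_sym.
have twice x y : @dist (compl T) x y + @dist (compl T) x y <= 5 + D.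
  have le_dist : @dist (compl T) x y <= 2 + D.
    rewrite dist_compl; apply: leq_add (leD x y).
    by apply: (@leq_add _ _ 1 1); apply: leq_b1.
  by apply: leq_trans (leq_add le_dist le_dist) _; case: D {leD le_dist}.
have [<-|nuv] := eqVneq u v; first by rewrite dist0 add0n.
have [<-|nvw] := eqVneq v w; first by rewrite dist0 addn0.
have [<-|nuw] := eqVneq u w; first by rewrite dist0 addn0 [X in _ + X]distC.
have le_edge : edge u v + edge v w + edge u w <= 2.
  have [uv|_] := boolP (edge u v); last by rewrite (leq_add (leq_b1 _) (leq_b1 _)).
  have [vw|_] := boolP (edge v w); last by rewrite ltnS leq_b1.
  by rewrite (no_triangle uv vw).
have le_dom : dominating u v + dominating v w + dominating u w <= D.
  have domF x y z : x != z -> dominating x y -> dominating y z = false.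
    by move=> nxz xy; apply: contra_neqF nxz => /(dominating_inj xy).
  have [uv|_] := boolP (dominating u v).
    have vu := etrans (dominating_sym v u) uv.
    by have := leD u v; rewrite uv (domF u) // (domF v) // !addn0.
  have [vw|_] := boolP (dominating v w); last by rewrite leD.
  have nvu : v != u by rewrite eq_sym.
  by have := leD v w; rewrite vw (dominating_sym u) (domF v) // addn0.
rewrite !dist_compl nuv nvw nuw.
have := leq_add (leqnn 3) (leq_add le_edge le_dom); rewrite addnA.
by apply: leq_trans; apply/eq_leq; case: (edge u v); case: (edge v w); case: (edge u w);
  case: (dominating u v); case: (dominating v w); case: (dominating u w).
Qed.

End AcyclicGraph.

Lemma bistar_dominating (T : sgraph) :
  is_bistar T -> exists u v : T, dominating u v.
Proof.
case=> n1 [n2 [_ _ [f [[g fK gK] f_edge]]]].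
exists (g (inl None)), (g (inr None)); apply/andP; split.
  by rewrite -f_edge !gK.
by apply/forallP=> x; rewrite -!f_edge !gK; case: (f x) => [[i|]|[i|]].
Qed.

(** A shortest path from a vertex to a nonadjacent one has at least three
    vertices. *)
Lemma connected_path3 (T : sgraph) (u b : T) :
  connected T -> b != u -> ~~ edge u b ->
  exists x y : T, [/\ edge u x, edge x y & u != y].
Proof.
move=> /(_ u b) /connectP[p up ->].
case/shortenP: up => -[|x [|y q]] /=; rewrite ?eqxx // ?andbT.
  by move=> ux _ _ _ /negP.
case/and3P=> ux xy _ /andP[]; rewrite !inE !negb_or => /and3P[_ nuy _] _ _ _ _.
by exists x, y.
Qed.

Theorem theorem4p2 (T : sgraph) (hT : is_tree T) (hn : 4 <= #|T|)
    (hstar : ~ is_star T) :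
  (is_bistar T -> triameter (compl T) = 6) /\
  (~ is_bistar T -> triameter (compl T) = 5).
Proof.
have [/card_gt0P[u _] connT acyclT] := hT.
have distE := dist_compl acyclT hstar.
have sum_le := dist_compl_sum acyclT hstar.
split=> [/bistar_dominating[x [y xy]] | not_bistar].
  apply: (@triameter_max (compl T) 6 x y y).
    by move=> ? ? ?; apply: leq_trans (sum_le _ _ _) _; case: [exists x, _].
  have [e _] := dominatingP xy.
  by rewrite !distE eqxx (edge_neq e) e xy /dominating edge_irrefl.
have not_dom x y : @dominating T x y = false.
  by apply/negP => /(dominating_bistar acyclT hstar).
have [b nbu nub] := nonadjacent_vertex acyclT hstar u.
have [x [y [ux xy nuy]]] := connected_path3 connT nbu nub.
apply: (@triameter_max (compl T) 5 u x y).
  move=> v w z; apply: leq_trans (sum_le _ _ _) _.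
  case: existsP => // -[v' /existsP[w']].
  by rewrite not_dom.
have nux := edge_neq ux; have nxy := edge_neq xy.
by rewrite !distE nux nxy nuy ux xy (no_triangle acyclT ux xy) !not_dom.
Qed.
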